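(* For every formula $\varphi\in\mathit{Fm}$, $\vdash_{\mathrm{HIPWK}}\varphi$ if and only if $\vdash_{\mathrm{IPC}}\varphi$.
   Context: Formulas $\mathit{Fm}$ are built over a countably infinite set $V$ of variables in the language $\{\land,\lor,\longrightarrow,\neg,0,1\}$. $\vdash_{\mathrm{IPC}}$ is intuitionistic propositional logic, which is the Hilbert-style logic with the axiom schemes (A1)–(A10) below and unrestricted modus ponens. HIPWK is the Hilbert-style logic with axiom schemes (A1) $\alpha\longrightarrow(\beta\longrightarrow\alpha)$; (A2) $(\alpha\longrightarrow(\beta\longrightarrow\gamma))\longrightarrow((\alpha\longrightarrow\beta)\longrightarrow(\alpha\longrightarrow\gamma))$; (A3) $\alpha\longrightarrow(\beta\longrightarrow(\alpha\land\beta))$; (A4) $\alpha\land\beta\longrightarrow\alpha$; (A5) $\alpha\land\beta\longrightarrow\beta$; (A6) $\alpha\longrightarrow\alpha\lor\beta$; (A7) $\beta\longrightarrow\alpha\lor\beta$; (A8) $(\alpha\longrightarrow\gamma)\longrightarrow((\beta\longrightarrow\gamma)\longrightarrow(\alpha\lor\beta\longrightarrow\gamma))$; (A9) $(\alpha\longrightarrow\beta)\longrightarrow((\alpha\longrightarrow\neg\beta)\longrightarrow\neg\alpha)$; (A10) $0\longrightarrow\alpha$, and the single rule (restricted modus ponens) $\frac{\alpha,\ \alpha\longrightarrow\beta}{\beta}$ provided $\mathrm{var}(\alpha)\subseteq\mathrm{var}(\beta)$, where $\mathrm{var}(\varphi)$ is the set of variables occurring in $\varphi$. $\vdash\varphi$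 means $\varphi$ is derivable from no hypotheses. *)

(* Defs.v *)
From Stdlib Require Import List.
Import ListNotations.

(* The countably infinite set V of variables is taken to be nat. *)
Inductive fm : Type :=
| Var (n : nat)
| And (a b : fm)
| Or (a b : fm)
| Imp (a b : fm)
| Neg (a : fm)
| Zero
| One.

Declare Scope fm_scope.
Delimit Scope fm_scope with fm.
Bind Scope fm_scope with fm.
Notation "a '∧' b" := (And a b) (at level 40, left associativity) : fm_scope.
Notation "a '∨' b" := (Or a b) (at level 50, left associativity) : fm_scope.
Notation "a '⟶' b" := (Imp a b) (at level 60, right associativity) : fm_scope.
Notation "'¬' a" := (Neg a) (at level 35, right associativity) : fm_scope.
Notation "0" := Zero : fm_scope.
Notation "1" := One : fm_scope.

(* Variables with repetition; only membership in this list is ever used. *)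
Fixpoint vars (a : fm) : list nat :=
  match a with
  | Var n => [n]
  | And b c | Or b c | Imp b c => vars b ++ vars c
  | Neg b => vars b
  | Zero | One => []
  end.

(* The constant 1 occurs in no axiom scheme. *)
Inductive Ax : fm -> Prop :=
| A1 (a b : fm) : Ax (a ⟶ (b ⟶ a))
| A2 (a b c : fm) : Ax ((a ⟶ (b ⟶ c)) ⟶ ((a ⟶ b) ⟶ (a ⟶ c)))
| A3 (a b : fm) : Ax (a ⟶ (b ⟶ (a ∧ b)))
| A4 (a b : fm) : Ax (a ∧ b ⟶ a)
| A5 (a b : fm) : Ax (a ∧ b ⟶ b)
| A6 (a b : fm) : Ax (a ⟶ a ∨ b)
| A7 (a b : fm) : Ax (b ⟶ a ∨ b)
| A8 (a b c : fm) : Ax ((a ⟶ c) ⟶ ((b ⟶ c) ⟶ (a ∨ b ⟶ c)))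
| A9 (a b : fm) : Ax ((a ⟶ b) ⟶ ((a ⟶ ¬ b) ⟶ ¬ a))
| A10 (a : fm) : Ax (0 ⟶ a).

Inductive IPC (Gamma : fm -> Prop) : fm -> Prop :=
| IPC_hyp (a : fm) : Gamma a -> IPC Gamma a
| IPC_ax (a : fm) : Ax a -> IPC Gamma a
| IPC_mp (a b : fm) : IPC Gamma a -> IPC Gamma (a ⟶ b) -> IPC Gamma b.

Inductive HIPWK (Gamma : fm -> Prop) : fm -> Prop :=
| HIPWK_hyp (a : fm) : Gamma a -> HIPWK Gamma a
| HIPWK_ax (a : fm) : Ax a -> HIPWK Gamma a
| HIPWK_rmp (a b : fm) :
    incl (vars a) (vars b) ->
    HIPWK Gamma a -> HIPWK Gamma (a ⟶ b) -> HIPWK Gamma b.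

Definition no_hyp : fm -> Prop := fun _ => False.

(* Main.v *)
Require Import Defs.
From Stdlib Require Import List.

(* Axiom schemes are closed under substitution, so a substitution instance of an IPC proof
   from no hypotheses is again such a proof. Modus ponens from a and a ⟶ b can therefore be
   replaced by its instance in which every variable outside b becomes the variable-free
   formula 0: this leaves b unchanged and puts all variables of a inside those of b. *)

Fixpoint subst (s : nat -> fm) (a : fm) : fm :=
  match a with
  | Var n => s n
  | And b c => And (subst s b) (subst s c)
  | Or b c => Or (subst s b) (subst s c)
  | Imp b c => Imp (subst s b) (subst s c)
  | Neg b => Neg (subst s b)
  | Zero => Zero
  | One => One
  end.

Definition restriction (l : list nat) (n : nat) : fm :=
  if in_dec PeanoNat.Nat.eq_dec n l then Var n else Zero.

Lemma subst_subst (s t : nat -> fm) (a : fm) :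
  subst t (subst s a) = subst (fun n => subst t (s n)) a.
Proof. induction a; simpl; congruence. Qed.

Lemma Ax_subst (s : nat -> fm) (a : fm) : Ax a -> Ax (subst s a).
Proof. intros []; simpl; constructor. Qed.

Lemma subst_Var (a : fm) : subst Var a = a.
Proof. induction a; simpl; congruence. Qed.

Lemma subst_restriction_id (l : list nat) (a : fm) :
  incl (vars a) l -> subst (restriction l) a = a.
Proof.
  induction a; simpl; intros Hl;
    try (apply incl_app_inv in Hl as [Hl1 Hl2]); try (f_equal; now auto).
  unfold restriction.
  destruct (in_dec _ n l) as [|Hn]; [easy|].
  destruct Hn; apply Hl; now left.
Qed.

Lemma vars_subst_restriction (l : list nat) (a : fm) :
  incl (vars (subst (restriction l) a)) l.
Proof.
  induction a; simpl; auto using incl_app, incl_nil_l.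
  unfold restriction.
  destruct (in_dec _ n l); simpl; auto using incl_cons, incl_nil_l.
Qed.

(** The quantifier over [s] is what makes the induction work: the modus ponens case uses both
    induction hypotheses at [s] followed by a restriction, not at [s] itself. *)
Lemma IPC_HIPWK_subst (a : fm) :
  IPC no_hyp a -> forall s : nat -> fm, HIPWK no_hyp (subst s a).
Proof.
  induction 1 as [a []|a Ha|a b _ IHa _ IHab]; intros s.
  - now apply HIPWK_ax, Ax_subst.
  (* The restricted rule has to conclude [subst s b], so the variables to keep are those of
     [subst s b] rather than those of [b]. *)
  - set (t := restriction (vars (subst s b))).
    specialize (IHa (fun n => subst t (s n))).
    specialize (IHab (fun n => subst t (s n))).
    rewrite <- subst_subst in IHa, IHab; simpl in IHab.
    assert (Hb : subst t (subst s b) = subst s b)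
      by apply subst_restriction_id, incl_refl.
    rewrite Hb in IHab.
    apply HIPWK_rmp with (2 := IHa); [|exact IHab].
    apply vars_subst_restriction.
Qed.

Lemma HIPWK_IPC (Gamma : fm -> Prop) (a : fm) : HIPWK Gamma a -> IPC Gamma a.
Proof. induction 1; eauto using IPC. Qed.

Theorem theorem4p10 (phi : fm) : HIPWK no_hyp phi <-> IPC no_hyp phi.
Proof.
  split; [apply HIPWK_IPC|].
  intros H; rewrite <- (subst_Var phi).
  now apply IPC_HIPWK_subst.
Qed.
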